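(* Let $G_n = a_1 \alpha_1^n + \cdots + a_d \alpha_d^n$ and $H_m = b_1 \beta_1^m + \cdots + b_t \beta_t^m$ be two simple linear recurrence sequences with $a_i, \alpha_i, b_j, \beta_j \in \mathbb{C}[x]\setminus\{0\}$ for $i=1,\ldots,d$ and $j=1,\ldots,t$. Assume that $G_n$ and $H_m$ both have weak coefficients, and index the roots so that $\alpha_1$ and $\beta_1$ are the first elements in the orderings used to define the relevant sets $R_G$ and $R_H$ of characteristic roots of $G_n$ and $H_m$. Assume that no element of $R_G$ or $R_H$ lies in $\mathbb{C}$ and no quotient of two distinct elements of $R_G$, or of two distinct elements of $R_H$, lies in $\mathbb{C}$. Moreover, suppose that every pair in $\{(\alpha_1,\gamma) : \gamma \in R_H\} \cup \{(\delta,\beta_1) : \delta \in R_G\}$ consists of multiplicatively independent elements, and that neither $G_n$ nor $H_m$ has multiple values. Then there exists an effectively computable constant $C$, depending only on the $a_i, \alpha_i, b_j, \beta_j$, such that for all distinct pairs $(n_1,m_1), (n_2,m_2) \in \mathbb{N}^2$ with $G_{n_1} - H_{m_1} = G_{n_2} - H_{m_2}$ we have $\max\{n_1,m_1,n_2,m_2\} \leq C$.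
   Context: $\mathbb{N}$ denotes the set of positive integers. A sequence $G_n = a_1\alpha_1^n+\cdots+a_d\alpha_d^n$ with $a_i,\alpha_i\in\mathbb{C}[x]$ has weak coefficients if for all $i,j$ and all $n\in\mathbb{N}$, $\deg\alpha_i > \deg\alpha_j$ implies $\deg(a_i\alpha_i^n) > \deg(a_j\alpha_j^n)$. For such a sequence, order the characteristic roots so that $\deg(a_1\alpha_1^n)=\cdots=\deg(a_k\alpha_k^n) > \deg(a_{k+1}\alpha_{k+1}^n)\geq\cdots\geq\deg(a_d\alpha_d^n)$; then $R_G=\{\alpha_1,\ldots,\alpha_k\}$ is the relevant set of characteristic roots of $G_n$ (similarly $R_H$ for $H_m$). $G_n$ has no multiple values if the map $n\mapsto G_n$ on $\mathbb{N}$ is injective. Two elements $\alpha,\beta$ are multiplicatively independent if $\alpha^r\beta^s\in\mathbb{C}$ with $r,s\in\mathbb{Z}$ implies $r=s=0$. *)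

(* Defs.v *)
From HB Require Import structures.
From mathcomp Require Import all_boot all_order all_algebra.
From mathcomp Require Import fraction complex reals.

Set Implicit Arguments.
Unset Strict Implicit.
Unset Printing Implicit Defensive.

Import GRing.Theory.
Local Open Scope ring_scope.

Section Recurrences.
Variable F : fieldType.
Implicit Types p q : {poly F}.

(* The junk value [deg 0 = 0] plays no role: degrees are only taken of nonzero
   polynomials below. *)
Definition deg p : nat := (size p).-1.

(* "f lies in F", for f in the rational function field F(x). *)
Definition is_constant (f : {fraction {poly F}}) : Prop :=
  exists c : F, f = tofrac c%:P.

Definition mult_independent p q : Prop :=
  forall r s : int, is_constant (tofrac p ^ r * tofrac q ^ s) ->
  r = 0 /\ s = 0.

Section OneSequence.
Variables (d : nat) (a alpha : 'I_d.+1 -> {poly F}).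

Definition recseq (n : nat) : {poly F} := \sum_(i < d.+1) a i * alpha i ^+ n.

(* The characteristic roots of a simple recurrence are pairwise distinct. *)
Definition simple_recurrence : Prop :=
  [/\ forall i, a i != 0, forall i, alpha i != 0 & injective alpha].

Definition weak_coefficients : Prop :=
  forall (i j : 'I_d.+1) (n : nat), (0 < n)%N ->
  (deg (alpha j) < deg (alpha i))%N ->
  (deg (a j * alpha j ^+ n)%R < deg (a i * alpha i ^+ n)%R)%N.

(* The roots are indexed so that, for every n >= 1, writing
   D_i = deg (a_i alpha_i^n),
     D_0 = ... = D_(k-1) > D_k >= D_(k+1) >= ... >= D_d. *)
Definition dominance_ordered (k : nat) : Prop :=
  (0 < k <= d.+1)%N /\
  forall n : nat, (0 < n)%N ->
  let D (i : 'I_d.+1) := deg (a i * alpha i ^+ n) in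
  [/\ forall i j : 'I_d.+1, (i < k)%N -> (j < k)%N -> D i = D j,
      forall i j : 'I_d.+1, (i < k)%N -> (k <= j)%N -> (D j < D i)%N
    & forall i j : 'I_d.+1, (k <= i)%N -> (i <= j)%N -> (D j <= D i)%N].

Definition relevant_roots (k : nat) : seq {poly F} :=
  [seq alpha i | i : 'I_d.+1 <- enum 'I_d.+1 & (i < k)%N].

Definition no_multiple_values : Prop :=
  forall n n' : nat, (0 < n)%N -> (0 < n')%N -> recseq n = recseq n' -> n = n'.

End OneSequence.
End Recurrences.

(* Effective computability from data in a field F, in the sense of
   Blum-Shub-Smale machines with equality tests: while-programs over finitely
   many registers holding natural numbers and one unbounded array of elements
   of F, with exact field operations and exact tests for zero. The only
   constants a program may mention are natural numbers, so a program is a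
   finite object that does not depend on F. *)
Inductive nexp : Type :=
| NConst of nat
| NReg of nat
| NAdd of nexp & nexp
| NSub of nexp & nexp
| NMul of nexp & nexp.

Inductive fexp : Type :=
| FConst of nat
| FCell of nexp
| FAdd of fexp & fexp
| FOpp of fexp
| FMul of fexp & fexp
| FInv of fexp.

Inductive cmd : Type :=
| Skip
| SetReg of nat & nexp
| SetCell of nexp & fexp
| TestZero of nat & fexp
| Seq of cmd & cmd
| While of nexp & cmd.

Section Semantics.
Variable F : fieldType.

Record state := State { regs : nat -> nat; cells : nat -> F }.

Fixpoint neval (s : state) (e : nexp) : nat :=
  match e with
  | NConst n => n
  | NReg i => regs s i
  | NAdd e1 e2 => neval s e1 + neval s e2
  | NSub e1 e2 => neval s e1 - neval s e2
  | NMul e1 e2 => neval s e1 * neval s e2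
  end%N.

Fixpoint feval (s : state) (e : fexp) : F :=
  match e with
  | FConst n => n%:R
  | FCell e1 => cells s (neval s e1)
  | FAdd e1 e2 => feval s e1 + feval s e2
  | FOpp e1 => - feval s e1
  | FMul e1 e2 => feval s e1 * feval s e2
  | FInv e1 => (feval s e1)^-1
  end.

Definition set_reg (s : state) (i v : nat) : state :=
  State [eta regs s with i |-> v] (cells s).

Definition set_cell (s : state) (i : nat) (v : F) : state :=
  State (regs s) [eta cells s with i |-> v].

(* [exec c s s']: started in state s, c terminates, in state s'. *)
Inductive exec : cmd -> state -> state -> Prop :=
| ExecSkip s : exec Skip s s
| ExecSetReg s i e : exec (SetReg i e) s (set_reg s i (neval s e))
| ExecSetCell s e f :
    exec (SetCell e f) s (set_cell s (neval s e) (feval s f))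
| ExecTestZero s i f :
    exec (TestZero i f) s (set_reg s i (nat_of_bool (feval s f == 0)))
| ExecSeq c1 c2 s s1 s2 :
    exec c1 s s1 -> exec c2 s1 s2 -> exec (Seq c1 c2) s s2
| ExecWhileStop e c s : neval s e = 0%N -> exec (While e c) s s
| ExecWhileStep e c s s1 s2 :
    neval s e <> 0%N -> exec c s s1 -> exec (While e c) s1 s2 ->
    exec (While e c) s s2.

(* The input word occupies the first cells and its length is in register 0;
   everything else is 0. The output is read in register 0. *)
Definition initial_state (w : seq F) : state :=
  State [eta (fun=> 0%N) with 0%N |-> size w] (fun i => w`_i).

Definition outputs (P : cmd) (w : seq F) (C : nat) : Prop :=
  exists2 s : state, exec P (initial_state w) s & regs s 0 = C.

(* Self-delimiting encodings: every list is preceded by its length, which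
   can be decoded when F has characteristic 0. *)
Definition encode_poly (p : {poly F}) : seq F := (size p)%:R :: p.

Definition encode_family (d : nat) (u : 'I_d.+1 -> {poly F}) : seq F :=
  d.+1%:R :: flatten [seq encode_poly (u i) | i <- enum 'I_d.+1].

Definition encode_data (d t : nat) (a alpha : 'I_d.+1 -> {poly F})
    (b beta : 'I_t.+1 -> {poly F}) : seq F :=
  encode_family a ++ encode_family alpha ++
  encode_family b ++ encode_family beta.

End Semantics.

(* Main.v *)
(* Write the equation as a vanishing sum of the terms a_i alpha_i^n and
   b_j beta_j^m. A Wronskian argument, in the spirit of Mason and of
   Brownawell-Masser, shows that any given term lies in a vanishing subsum all
   of whose terms have pairwise quotients of bounded degree, the bound depending
   only on the number of terms and on the degrees of the a's, alpha's, b's and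
   beta's. Apply this to a leading term, say a_1 alpha_1^n with n the larger of
   n_1, n_2 and deg G_n >= deg H_m: for its degree to cancel, its subsum must
   contain another term of top degree, which can only be a_i alpha_i^n or
   b_j beta_j^m with a relevant root. In the first case n is bounded because
   alpha_1 / alpha_i is not constant, in the second because alpha_1 and beta_j
   are multiplicatively independent; comparing degrees then bounds m. The final
   bound is a polynomial in the length of the encoding of the data, so the
   program only has to evaluate that polynomial. *)
Require Import Defs.
From HB Require Import structures.
From mathcomp Require Import all_boot all_order all_algebra.
From mathcomp Require Import fraction complex reals.
From mathcomp Require Import perm ring zify.

Set Implicit Arguments.
Unset Strict Implicit.
Unset Printing Implicit Defensive.

Import Order.TTheory GRing.Theory Num.Theory.
Local Open Scope ring_scope.
Local Open Scope complex_scope.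

(** * Degrees of sums, products and determinants of polynomials *)

Section Degree.
Variable F : fieldType.
Implicit Types p q : {poly F}.

Lemma size_deg p : p != 0 -> size p = (deg p).+1.
Proof. by rewrite -size_poly_gt0 => /prednK. Qed.

Lemma degM p q : p != 0 -> q != 0 -> deg (p * q) = (deg p + deg q)%N.
Proof.
by move=> p0 q0; rewrite {1}/deg size_mul // !size_deg // addnS.
Qed.

Lemma degX p n : deg (p ^+ n) = (n * deg p)%N.
Proof. by rewrite /deg size_exp mulnC. Qed.

Lemma size_le_deg p n : (deg p <= n)%N = (size p <= n.+1)%N.
Proof. by rewrite /deg -subn1 leq_subLR add1n. Qed.

Lemma deg_mul_leq p q : (deg (p * q) <= deg p + deg q)%N.
Proof.
have [->|p0] := eqVneq p 0; first by rewrite mul0r /deg size_poly0.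
have [->|q0] := eqVneq q 0; first by rewrite mulr0 /deg size_poly0.
by rewrite degM.
Qed.

Lemma deg_add_leq p q n : (deg p <= n -> deg q <= n -> deg (p + q) <= n)%N.
Proof.
rewrite !size_le_deg => hp hq; apply: leq_trans (size_polyD _ _) _.
by rewrite geq_max hp hq.
Qed.

Lemma deg_sum_leq (I : finType) (P : pred I) (p : I -> {poly F}) n :
  (forall i, P i -> deg (p i) <= n)%N -> (deg (\sum_(i | P i) p i) <= n)%N.
Proof.
move=> h; apply: (big_ind (fun q : {poly F} => deg q <= n)%N) => //.
  by rewrite /deg size_poly0.
by move=> *; apply: deg_add_leq.
Qed.

Lemma deg_prod_leq (I : finType) (p : I -> {poly F}) (e : I -> nat) :
  (forall i, deg (p i) <= e i)%N -> (deg (\prod_i p i) <= \sum_i e i)%N.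
Proof.
move=> h; apply: (big_ind2 (fun (q : {poly F}) n => deg q <= n)%N) => //.
  by rewrite /deg size_poly1.
move=> q1 n1 q2 n2 h1 h2; apply: leq_trans (deg_mul_leq _ _) _.
exact: leq_add.
Qed.

Lemma deg_det_leq n (A : 'M[{poly F}]_n) (e : 'I_n -> nat) :
  (forall i j, deg (A i j) <= e i)%N -> (deg (\det A) <= \sum_i e i)%N.
Proof.
move=> h; apply: deg_sum_leq => s _.
rewrite -signr_odd mulrC.
apply: leq_trans (deg_mul_leq _ _) _.
have -> : deg ((-1) ^+ odd s : {poly F}) = 0%N.
  by case: (odd s); rewrite ?expr1 /deg ?size_polyN size_poly1.
rewrite addn0; exact: deg_prod_leq.
Qed.

Lemma coef_mul_deg p q m n : (deg p <= m)%N -> (deg q <= n)%N ->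
  (p * q)`_(m + n) = p`_m * q`_n.
Proof.
rewrite !size_le_deg => hp hq; rewrite coefM.
have hm : (m < (m + n).+1)%N by lia.
rewrite (bigD1 (Ordinal hm)) //= addKn big1 ?addr0 // => i.
rewrite -val_eqE /= => ne.
have [lt_mi|le_im] := ltnP m i.
  by rewrite (nth_default _ (leq_trans hp lt_mi)) mul0r.
by rewrite [q`__]nth_default ?mulr0 //; apply: leq_trans hq _; lia.
Qed.

Lemma coef_prod_deg (I : finType) (p : I -> {poly F}) (e : I -> nat) :
  (forall i, deg (p i) <= e i)%N ->
  (\prod_i p i)`_(\sum_i e i) = \prod_i (p i)`_(e i).
Proof.
move=> h.
pose K (q : {poly F}) (n : nat) (v : F) := (deg q <= n)%N /\ q`_n = v.
suff: K (\prod_i p i) (\sum_i e i)%N (\prod_i (p i)`_(e i)) by case.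
apply: (big_rec3 K) => [|i v n q _ [h1 <-]].
  by split; rewrite ?coef1 // /deg size_poly1.
split; last exact: coef_mul_deg.
by apply: leq_trans (deg_mul_leq _ _) _; apply: leq_add.
Qed.

(** The bounds go by columns, and each Leibniz product meets every column once, so its coefficient
    in the total degree is the product of the coefficients of its entries in their column
    degrees. *)
Lemma coef_det_deg n (A : 'M[{poly F}]_n) (e : 'I_n -> nat) :
  (forall i j, deg (A i j) <= e j)%N ->
  (\det A)`_(\sum_j e j) = \det (\matrix_(i, j) (A i j)`_(e j)).
Proof.
move=> h; rewrite /determinant coef_sum; apply: eq_bigr => s _.
have -> : ((-1) ^+ s : {poly F}) = ((-1) ^+ s)%:P by rewrite rmorphXn rmorphN1.
rewrite mul_polyC coefZ [X in _`_X](reindex_inj (@perm_inj _ s)).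
rewrite coef_prod_deg //.
by congr (_ * _); apply: eq_bigr => i _; rewrite mxE.
Qed.

End Degree.

(** * Wronskians for the Euler operator *)

Section Wronskian.
Variable F : numFieldType.
Implicit Types p q : {poly F}.

(** Preferred to the plain derivative because it is diagonal on monomials: the coefficient in a
    fixed degree is only rescaled. *)
Definition euler p := 'X * p^`().

Lemma euler_is_linear : linear euler.
Proof. by move=> c p q; rewrite /euler derivD derivZ mulrDr scalerAr. Qed.

HB.instance Definition _ :=
  GRing.isLinear.Build F {poly F} {poly F} _ euler euler_is_linear.

Lemma eulerM p q : euler (p * q) = euler p * q + p * euler q.
Proof. by rewrite /euler derivM; ring. Qed.

Lemma eulerX p n : p * euler (p ^+ n) = n%:R * euler p * p ^+ n.
Proof.
elim: n => [|n IH]; first by rewrite expr0 /euler derivC; ring.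
by rewrite exprS eulerM mulrDr IH -natr1; ring.
Qed.

Lemma coef_euler p n : (euler p)`_n = n%:R * p`_n.
Proof.
rewrite /euler mulrC coefMX coef_deriv.
by case: n => [|n]; rewrite ?mul0r //= mulr_natl.
Qed.

Lemma coef_iter_euler k p n : (iter k euler p)`_n = n%:R ^+ k * p`_n.
Proof.
by elim: k => [|k IH]; rewrite ?mul1r //= coef_euler IH exprS mulrA.
Qed.

Lemma deg_euler p : (deg (euler p) <= deg p)%N.
Proof.
rewrite size_le_deg; apply/leq_sizeP => j hj.
by rewrite coef_euler nth_default ?mulr0 // (leq_trans (leqSpred _) hj).
Qed.

Lemma deg_iter_euler k p : (deg (iter k euler p) <= deg p)%N.
Proof. by elim: k => //= k IH; apply: leq_trans (deg_euler _) IH. Qed.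

Lemma iter_euler_sum k (I : finType) (c : I -> F) (p : I -> {poly F}) :
  iter k euler (\sum_i c i *: p i) = \sum_i c i *: iter k euler (p i).
Proof.
elim: k => //= k ->; rewrite linear_sum.
by apply: eq_bigr => i _; rewrite linearZ.
Qed.

Definition wronskian r (f : 'I_r -> {poly F}) : {poly F} :=
  \det (\matrix_(k < r, i < r) iter k euler (f i)).

Definition subst_at r (f : 'I_r -> {poly F}) (i : 'I_r) (p : {poly F}) :=
  fun l => if l == i then p else f l.

(** As [euler] is linear over F, the substitution multiplies the matrix on the right by the identity
    with column [i] replaced by [c], as in Cramer's rule. *)
Lemma wronskian_subst r (f : 'I_r -> {poly F}) i (c : 'I_r -> F) :
  wronskian (subst_at f i (\sum_l c l *: f l)) = c i *: wronskian f.
Proof.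
pose A : 'M[{poly F}]_r :=
  \matrix_(l, m) (if m == i then (c l)%:P else (l == m)%:R).
have -> : wronskian (subst_at f i (\sum_l c l *: f l)) =
  \det (\matrix_(k < r, i < r) iter k euler (f i) *m A).
  congr (\det _); apply/matrixP => k m; rewrite !mxE /subst_at.
  have [->|ne_mi] := eqVneq m i.
    rewrite iter_euler_sum; apply: eq_bigr => l _.
    by rewrite !mxE eqxx mulrC mul_polyC.
  rewrite (bigD1 m) //= !mxE eqxx (negbTE ne_mi) mulr1 big1 ?addr0 // => l ne.
  by rewrite !mxE (negbTE ne_mi) (negbTE ne) mulr0.
rewrite det_mulmx mulrC -mul_polyC; congr (_ * _).
(* Row [i] of [A] is zero off the diagonal, and the one surviving minor is that of an identity
   matrix. *)
rewrite (expand_det_row _ i) (bigD1 i) //= mxE eqxx big1 ?addr0 => [|m ne].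
  rewrite /cofactor -signr_odd oddD addbb expr0 mul1r.
  rewrite (_ : row' i (col' i A) = 1%:M) ?det1 ?mulr1 //.
  apply/matrixP => l m; rewrite !mxE.
  by rewrite eq_sym (negbTE (neq_lift _ _)) (inj_eq lift_inj).
by rewrite mxE (negbTE ne) eq_sym (negbTE ne) mul0r.
Qed.

Definition free_family r (f : 'I_r -> {poly F}) :=
  forall c : 'I_r -> F, \sum_i c i *: f i = 0 -> forall i, c i = 0.

Lemma free_family_neq0 r (f : 'I_r -> {poly F}) i : free_family f -> f i != 0.
Proof.
move=> ff; apply/eqP => fi0.
have := ff (fun l => (l == i)%:R); rewrite (bigD1 i) //= fi0 scaler0 add0r.
rewrite big1 => [|l /negbTE->]; last by rewrite scale0r.
by move=> /(_ erefl i)/eqP; rewrite eqxx oner_eq0.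
Qed.

(* Since [euler] multiplies X^s by s, the top coefficients form a Vandermonde
   matrix in the degrees. *)
Lemma wronskian_neq0_deg_inj r (f : 'I_r -> {poly F}) :
  (forall i, f i != 0) -> injective (fun i => deg (f i)) -> wronskian f != 0.
Proof.
move=> f0 inj.
suff: (wronskian f)`_(\sum_i deg (f i)) != 0.
  by apply: contraNneq => ->; rewrite coef0.
rewrite coef_det_deg => [|k i]; last by rewrite mxE deg_iter_euler.
rewrite (_ : (\matrix_(_, _) _) =
  Vandermonde r (\row_i (deg (f i))%:R) *m diag_mx (\row_i lead_coef (f i))).
  rewrite det_mulmx det_Vandermonde det_diag mulf_neq0 //.
    (* The Vandermonde nodes are the degrees seen in F, which stay distinct because F has
       characteristic zero. *)
    apply/prodf_neq0 => i _; apply/prodf_neq0 => j lt_ij.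
    rewrite !mxE subr_eq0 eqr_nat; apply: contraTneq lt_ij => /inj ->.
    by rewrite ltnn.
  by apply/prodf_neq0 => i _; rewrite mxE lead_coef_eq0.
apply/matrixP => k i; rewrite mul_mx_diag !mxE coef_iter_euler.
by rewrite lead_coefE.
Qed.

(** Induction on the total size. If two members have the same degree, subtracting a multiple of one
    from the other cancels the leading coefficient; this column operation preserves both the
    Wronskian and freeness. Otherwise all degrees are distinct. *)
Lemma wronskian_neq0 r (f : 'I_r -> {poly F}) :
  free_family f -> wronskian f != 0.
Proof.
have [n] := ubnP (\sum_i size (f i)); elim: n f => // n IH f le_n ff.
have f0 i := free_family_neq0 i ff.
have [/injectiveP inj|] := boolP (injectiveb (fun i => deg (f i))).
  exact: wronskian_neq0_deg_inj.
move=> /injectivePn[i [j ne_ij eq_ij]].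
have eq_size : size (f i) = size (f j).
  by rewrite !size_deg // eq_ij.
pose t := lead_coef (f i) / lead_coef (f j).
pose c l : F := if l == i then 1 else if l == j then - t else 0.
pose p := f i - t *: f j.
have sum_c : \sum_l c l *: f l = p.
  rewrite (bigD1 i) //= (bigD1 j) 1?eq_sym //= big1 => [|l /andP[ni nj]].
    by rewrite /c eqxx [j == i]eq_sym (negbTE ne_ij) eqxx scale1r scaleNr addr0.
  by rewrite /c (negbTE ni) (negbTE nj) scale0r.
have := wronskian_subst f i c; rewrite sum_c /c eqxx scale1r => <-.
apply: IH.
  suff lt_p : (size p < size (f i))%N.
    have: (\sum_l size (subst_at f i p l) < \sum_l size (f l))%N.
      rewrite (bigD1 i) //= [X in (_ < X)%N](bigD1 i) //= /subst_at eqxx.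
      rewrite -addSn leq_add // leq_sum // => l /negbTE->.
      by [].
    by move: le_n; lia.
  have fi_gt0 : (0 < size (f i))%N by rewrite size_poly_gt0.
  rewrite -(prednK fi_gt0) ltnS; apply/leq_sizeP => m hm.
  rewrite coefB coefZ.
  move: hm; rewrite leq_eqVlt => /orP[/eqP<-|hm].
    rewrite -lead_coefE eq_size -lead_coefE mulrVK ?subrr //.
    by rewrite unitfE lead_coef_eq0.
  move: hm; rewrite prednK // => hm.
  by rewrite !nth_default ?mulr0 ?subrr // -eq_size.
move=> e he.
(* A relation [e] on the modified family is rewritten as a relation on [f]; only the coefficient at
   [j] changes. *)
have he' : \sum_l (if l == j then e j - e i * t else e l) *: f l = 0.
  rewrite -[RHS]he (bigD1 i) //= (bigD1 j) 1?eq_sym //=.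
  rewrite [RHS](bigD1 i) //= [X in _ = _ + X](bigD1 j) 1?eq_sym //=.
  rewrite /subst_at eqxx (negbTE ne_ij) [j == i]eq_sym (negbTE ne_ij) eqxx.
  rewrite [X in _ = _ + (_ + X)](eq_bigr (fun l => e l *: f l)); last first.
    by move=> l /andP[/negbTE-> _].
  rewrite [X in _ + (_ + X) = _](eq_bigr (fun l => e l *: f l)); last first.
    by move=> l /andP[_ /negbTE->].
  rewrite !addrA; congr (_ + _).
  by rewrite /p scalerBr scalerBl scalerA -!addrA; congr (_ + _); rewrite addrC.
have ei : e i = 0 by have := ff _ he' i; rewrite (negbTE ne_ij).
move=> l; have := ff _ he' l; case: eqVneq => [->|//].
by rewrite ei mul0r subr0.
Qed.
End Wronskian.

Arguments euler {F} p.

(** A maximal set of independent rows of the coefficient matrix. The basis is drawn from the family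
    itself, so its members inherit any property shared by all the [f i]. *)
Lemma exists_free_spanning (F : numFieldType) (I : finType)
    (f : I -> {poly F}) :
  exists (r : nat) (h : 'I_r -> I) (c : I -> 'I_r -> F),
  [/\ (r <= #|I|)%N, free_family (f \o h)
    & forall j, f j = \sum_i c j i *: f (h i)].
Proof.
pose s := \max_i size (f i).
have fs j : (size (f j) <= s)%N by apply: (leq_bigmax j).
pose A : 'M[F]_(#|I|, s) := \matrix_(j < #|I|) poly_rV (f (enum_val j)).
pose h := [ffun i => enum_val (maxrankfun A i)].
pose B := rowsub (maxrankfun A) A.
have row_comb (c : 'rV[F]_(\rank A)) :
    rVpoly (c *m B) = \sum_i c 0 i *: f (h i).
  rewrite mulmx_sum_row linear_sum; apply: eq_bigr => i _.
  by rewrite linearZ /= row_rowsub rowK poly_rV_K // ffunE.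
have subAB : (A <= B)%MS by rewrite eq_maxrowsub.
exists (\rank A), h, (fun j => (A *m pinvmx B) (enum_rank j)); split.
- exact: rank_leq_row.
- move=> c sum0 i.
  have /eqP : (\row_l c l) *m B = 0.
    apply: (can_inj rVpolyK); rewrite row_comb linear0 -[RHS]sum0.
    by apply: eq_bigr => l _; rewrite mxE.
  rewrite mulmx_free_eq0 ?maxrowsub_free // => /eqP/rowP/(_ i).
  by rewrite !mxE.
move=> j; rewrite -[LHS](poly_rV_K (fs j)).
have -> : poly_rV (f j) = row (enum_rank j) (A *m pinvmx B) *m B.
  by rewrite -row_mul mulmxKpV // rowK enum_rankK.
by rewrite row_comb; apply: eq_bigr => i _; rewrite mxE.
Qed.

(** * Quotients of bounded degree *)

Section BoundedRatio.
Variable F : fieldType.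
Implicit Types f h : {poly F}.

(* f / h is a rational function of degree at most M. *)
Definition ratio_bounded M f h := exists G H,
  [/\ G != 0, H != 0, f * G = h * H, (deg G <= M)%N & (deg H <= M)%N].

Lemma ratio_bounded_refl M f : ratio_bounded M f f.
Proof. by exists 1, 1; rewrite oner_eq0 /deg size_poly1. Qed.

Lemma ratio_bounded_trans M1 M2 f1 f2 f3 :
  ratio_bounded M1 f1 f2 -> ratio_bounded M2 f2 f3 ->
  ratio_bounded (M1 + M2) f1 f3.
Proof.
move=> [G1 [H1 [nG1 nH1 e1 dG1 dH1]]] [G2 [H2 [nG2 nH2 e2 dG2 dH2]]].
exists (G1 * G2), (H1 * H2); split; rewrite ?mulf_neq0 //.
- by rewrite mulrA e1 mulrAC e2; ring.
- by rewrite degM // leq_add.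
- by rewrite degM // leq_add.
Qed.

Lemma ratio_bounded_leq M1 M2 f h : (M1 <= M2)%N ->
  ratio_bounded M1 f h -> ratio_bounded M2 f h.
Proof.
move=> le [G [H [nG nH e dG dH]]].
by exists G, H; split=> //; apply: leq_trans le.
Qed.

Lemma ratio_bounded_path M (T : eqType) (f : T -> {poly F}) (e : rel T) x p :
  (forall y z, e y z -> ratio_bounded M (f y) (f z)) -> path e x p ->
  ratio_bounded (size p * M) (f x) (f (last x p)).
Proof.
move=> he; elim: p x => [|y p IH] x /=.
  by move=> _; apply: ratio_bounded_refl.
move=> /andP[exy hp]; rewrite mulSn.
exact: ratio_bounded_trans (he _ _ exy) (IH _ hp).
Qed.

End BoundedRatio.

(** * Vanishing sums of products of divisors of a fixed polynomial *)

Section SUnits.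
Variables (F : numFieldType) (Q : {poly F}).
Implicit Types f h p : {poly F}.

(* Satisfied by all products of divisors of Q, with a bound on the numerator
   of Q f'/f which is uniform in the exponents. *)
Definition log_derivable f :=
  exists2 g, Q * euler f = f * g & (deg g <= deg Q)%N.

Lemma log_derivableC c : log_derivable c%:P.
Proof.
exists 0; last by rewrite /deg size_poly0.
by rewrite /euler derivC !mulr0.
Qed.

Lemma log_derivableM f h :
  log_derivable f -> log_derivable h -> log_derivable (f * h).
Proof.
move=> [g1 e1 d1] [g2 e2 d2]; exists (g1 + g2); last exact: deg_add_leq.
rewrite eulerM mulrDr mulrA e1.
by rewrite [Q * (f * _)]mulrCA e2; ring.
Qed.

Lemma log_derivableX f n : log_derivable f -> log_derivable (f ^+ n).
Proof.
move=> hf; elim: n => [|n IH]; first by rewrite expr0; apply: log_derivableC.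
by rewrite exprS; apply: log_derivableM.
Qed.

Hypothesis Q_neq0 : Q != 0.

Lemma log_derivable_dvd f : f %| Q -> log_derivable f.
Proof.
move=> /dvdpP[p eQ]; exists (p * euler f); first by rewrite {1}eQ; ring.
move: Q_neq0; rewrite eQ mulf_eq0 negb_or => /andP[p0 f0].
by apply: leq_trans (deg_mul_leq _ _) _; rewrite degM // leq_add2l deg_euler.
Qed.

Lemma iter_euler_log_derivable f k : log_derivable f ->
  exists2 g, Q ^+ k * iter k euler f = f * g & (deg g <= k * deg Q)%N.
Proof.
move=> [g eg dg]; elim: k => [|k [u eu du]].
  by exists 1; rewrite ?mul1r ?mulr1 // /deg size_poly1.
(* Obtained by applying [Q * euler] to the identity at [k] and substituting the identities for
   [Q * euler f] and [Q ^+ k * iter k euler f]. *)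
exists (g * u + Q * euler u - k%:R * euler Q * u).
  have := congr1 (fun p => Q * euler p) eu.
  rewrite !eulerM !mulrDr mulrA eulerX -/(iter k.+1 euler f) => eD.
  have -> : Q ^+ k.+1 * iter k.+1 euler f =
    Q * (euler f * u) + Q * (f * euler u)
      - k%:R * euler Q * (Q ^+ k * iter k euler f).
    by rewrite -eD exprS; ring.
  by rewrite eu mulrA eg; ring.
rewrite mulSn; apply: deg_add_leq; first apply: deg_add_leq.
- by apply: leq_trans (deg_mul_leq _ _) _; apply: leq_add.
- apply: leq_trans (deg_mul_leq _ _) _; rewrite leq_add2l.
  exact: leq_trans (deg_euler _) _.
rewrite /deg size_polyN -/(deg _); apply: leq_trans (deg_mul_leq _ _) _.
rewrite leq_add //; apply: leq_trans (deg_mul_leq _ _) _.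
rewrite -polyC_natr [deg _%:P]/deg size_polyC.
by case: eqP => _; exact: deg_euler.
Qed.

(** Scaling row [k] by [Q ^+ k] lets [f i] be factored out of column [i]; the determinant of the
    cofactors that remain has degree bounded independently of the degrees of the [f i]. *)
Lemma wronskian_log_derivable r (f : 'I_r -> {poly F}) :
  (forall i, log_derivable (f i)) ->
  exists2 G, Q ^+ (\sum_(k < r) k) * wronskian f = \prod_i f i * G
    & (deg G <= r * r * deg Q)%N.
Proof.
move=> lf.
have /fin_all_exists[g hg] (k : 'I_r) : exists u : 'I_r -> {poly F},
    forall i, Q ^+ k * iter k euler (f i) = f i * u i /\
              (deg (u i) <= k * deg Q)%N.
  have gi i : exists u, Q ^+ k * iter k euler (f i) = f i * u /\
                        (deg u <= k * deg Q)%N.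
    by have [u eu du] := iter_euler_log_derivable k (lf i); exists u.
  exact: fin_all_exists gi.
exists (\det (\matrix_(k, i) g k i)).
  have detD (d : 'I_r -> {poly F}) : \det (diag_mx (\row_i d i)) = \prod_i d i.
    by rewrite det_diag; apply: eq_bigr => i _; rewrite mxE.
  rewrite -prodrXr -(detD (fun k : 'I_r => Q ^+ k)) -detD.
  rewrite -det_mulmx mulrC -det_mulmx; congr (\det _).
  apply/matrixP => k i; rewrite mul_diag_mx mul_mx_diag !mxE.
  by rewrite (proj1 (hg k i)) mulrC.
apply: leq_trans (deg_det_leq (e := fun k : 'I_r => (r * deg Q)%N) _) _.
  move=> k i; rewrite mxE; apply: leq_trans (proj2 (hg k i)) _.
  by rewrite leq_mul2r orbC ltnW.
by rewrite sum_nat_const card_ord mulnA.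
Qed.

(** Putting [p1] or [p2] in place of [f i] multiplies the Wronskian by a nonzero constant. Factoring
    both new Wronskians leaves the same product of the other [f l], which cancels in the
    quotient. *)
Lemma ratio_bounded_span r (f : 'I_r -> {poly F}) i (c1 c2 : 'I_r -> F) p1 p2 :
  (forall l, log_derivable (f l)) -> free_family f ->
  log_derivable p1 -> log_derivable p2 ->
  p1 = \sum_l c1 l *: f l -> p2 = \sum_l c2 l *: f l ->
  c1 i != 0 -> c2 i != 0 -> ratio_bounded (r * r * deg Q) p1 p2.
Proof.
move=> lf ff l1 l2 e1 e2 n1 n2.
have W0 := wronskian_neq0 ff.
have nT : \prod_(l | l != i) f l != 0.
  by apply/prodf_neq0 => l _; apply: free_family_neq0.
have key p c : log_derivable p -> p = \sum_l c l *: f l -> c i != 0 ->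
    exists G, [/\ G != 0, (deg G <= r * r * deg Q)%N &
      p * G * \prod_(l | l != i) f l =
      c i *: (Q ^+ (\sum_(k < r) k) * wronskian f)].
  move=> lp ep ci0.
  have [|G eG dG] := wronskian_log_derivable (f := subst_at f i p).
    by move=> l; rewrite /subst_at; case: eqP.
  have eq_p : p * G * \prod_(l | l != i) f l =
      c i *: (Q ^+ (\sum_(k < r) k) * wronskian f).
    rewrite scalerAr -wronskian_subst -ep eG [X in _ = X * _](bigD1 i) //=.
    rewrite {1}/subst_at eqxx.
    rewrite mulrAC; congr (_ * _ * _).
    by apply: eq_bigr => l /negbTE nl; rewrite /subst_at nl.
  exists G; split=> //; apply/eqP => G0.
  have := eq_p; rewrite G0 mulr0 mul0r => /esym/eqP.
  rewrite scaler_eq0 mulf_eq0 expf_eq0.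
  by rewrite (negbTE ci0) (negbTE W0) (negbTE Q_neq0) andbF.
have [G1 [nG1 d1 E1]] := key _ _ l1 e1 n1.
have [G2 [nG2 d2 E2]] := key _ _ l2 e2 n2.
exists (c2 i *: G1), (c1 i *: G2).
rewrite !scaler_eq0 !negb_or /deg !size_scale //; split; try exact/andP.
- apply: (mulIf nT); rewrite -!scalerAr -!scalerAl E1 E2 !scalerA.
  by rewrite mulrC.
- exact: d1.
- exact: d2.
Qed.

(* The relation "f_j and f_j' involve a common basis element" splits the family
   into classes, and linear independence forces each class to sum to 0. *)
Lemma vanishing_sum_component (I : finType) (f : I -> {poly F}) (i0 : I) :
  (forall i, log_derivable (f i)) -> \sum_i f i = 0 ->
  exists J : {set I}, [/\ i0 \in J, \sum_(j in J) f j = 0 &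
    forall j, j \in J -> ratio_bounded (#|I| ^ 3 * deg Q) (f i0) (f j)].
Proof.
move=> lf sum0.
have [r [h [c [le_r fh ec]]]] := exists_free_spanning f.
pose e := [rel j j' | [exists i, (c j i != 0) && (c j' i != 0)]].
exists [set j | connect e i0 j]; split; first by rewrite inE connect0.
  have sum_c (P : pred I) :
      \sum_(j | P j) f j = \sum_i (\sum_(j | P j) c j i) *: f (h i).
    rewrite (eq_bigr _ (fun j _ => ec j)) exchange_big /=.
    by apply: eq_bigr => i _; rewrite scaler_suml.
  have c0 := fh _ (etrans (esym (sum_c xpredT)) sum0).
  rewrite sum_c big1 // => i _.
  rewrite (_ : \sum_(j in _) _ = 0) ?scale0r //.
  (* If basis element [i] occurs in the class, all indices involving it lie in the class, so its
     coefficient is that of the whole sum, which is zero. Otherwise every contribution is zero. *)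
  have [/existsP[j /andP[Jj cj]]|no] :=
      boolP [exists j, connect e i0 j && (c j i != 0)].
    rewrite -[RHS](c0 i).
    rewrite [RHS](bigID (fun j => j \in [set j | connect e i0 j])) /=.
    rewrite [X in _ = _ + X]big1 ?addr0 // => j'; rewrite inE => nJ.
    apply: contraNeq nJ => cj'; apply: connect_trans Jj _.
    by apply: connect1; apply/existsP; exists i; rewrite cj.
  apply: big1 => j; rewrite inE => Jj; apply: contraNeq no => cj.
  by apply/existsP; exists j; rewrite Jj.
(* A path without repetition has at most [#|I|] edges, each costing at most [#|I| ^ 2 * deg Q]. *)
move=> j; rewrite inE => /connectP[p0 /shortenP[p hp up _] ->].
have lt_p : (size p <= #|I|)%N.
  by have := max_card (mem (i0 :: p)); rewrite (card_uniqP up) /= => /ltnW.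
apply: ratio_bounded_leq (ratio_bounded_path (M := #|I| ^ 2 * deg Q) _ hp).
  by rewrite mulnA [(_ ^ 3)%N]expnS !leq_mul.
move=> y z /existsP[i /andP[cy cz]].
apply: ratio_bounded_leq
  (ratio_bounded_span _ fh _ _ (ec y) (ec z) cy cz) => //.
  by rewrite -mulnn leq_mul // leq_mul.
by move=> l; apply: lf.
Qed.

End SUnits.

(** * Multiplicities of roots *)

Section Multiplicity.
Variable F : fieldType.
Implicit Types p q : {poly F}.

Lemma mupX (x : F) p n : p != 0 -> mup x (p ^+ n) = (n * mup x p)%N.
Proof.
move=> p0; elim: n => [|n IH].
  by rewrite expr0 mul0n mupNroot // /root hornerC oner_eq0.
by rewrite exprS mupM ?expf_neq0 // IH mulSn.
Qed.

Lemma mup_leq_deg (x : F) p : p != 0 -> (mup x p <= deg p)%N.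
Proof.
move=> p0; have := dvdp_leq p0 (_ : ('X - x%:P) ^+ mup x p %| p).
rewrite -mup_geq // => /(_ (leqnn _)).
by rewrite size_exp_XsubC size_deg.
Qed.

Lemma mup_prod_XsubC (x : F) (r : seq F) :
  mup x (\prod_(z <- r) ('X - z%:P)) = count_mem x r.
Proof.
elim: r => [|z r IH].
  by rewrite big_nil mupNroot // /root hornerC oner_eq0.
rewrite big_cons mupM ?polyXsubC_eq0 ?monic_neq0 ?monic_prod_XsubC // IH /=.
by congr (_ + _)%N; have := mup_XsubCX 1 x z; rewrite expr1 => ->; case: eqP.
Qed.

End Multiplicity.

(** * Bounding exponents by comparing multiplicities over a closed field *)

Section ClosedField.
Variable F : closedFieldType.
Implicit Types p q A B : {poly F}.

Lemma eq_mup_proportional p q : p != 0 -> q != 0 ->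
  (forall x, mup x p = mup x q) -> exists c, p = c *: q.
Proof.
move=> p0 q0 eq_mup.
have [r er] := closed_field_poly_normal p.
have [s es] := closed_field_poly_normal q.
have lp : lead_coef p != 0 by rewrite lead_coef_eq0.
have lq : lead_coef q != 0 by rewrite lead_coef_eq0.
have mupZ (c : F) (u : seq F) x : c != 0 ->
    mup x (c *: \prod_(z <- u) ('X - z%:P)) = count_mem x u.
  by move=> c0; rewrite -mul_polyC mupMr ?mup_prod_XsubC // /root hornerC.
have rs : perm_eq r s.
  apply/allP => x _ /=; apply/eqP; have := eq_mup x.
  by rewrite er es !mupZ.
exists (lead_coef p / lead_coef q).
by rewrite {1}er {2}es scalerA mulfVK // (perm_big _ rs).
Qed.

Lemma is_constant_ratio p q : p != 0 -> q != 0 ->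
  (forall x, mup x p = mup x q) -> is_constant (tofrac p / tofrac q).
Proof.
move=> p0 q0 /(eq_mup_proportional p0 q0)[c ->]; exists c.
by rewrite -mul_polyC tofracM mulfK // tofrac_eq0.
Qed.

(** At any point [x] the multiplicities of [A] and [B] differ by [n] times the difference of those
    of [p] and [q]. If [n > M] the latter must vanish everywhere, making [p / q] constant. *)
Lemma ratio_power_bound p q n M : p != 0 -> q != 0 ->
  ~ is_constant (tofrac p / tofrac q) ->
  forall A B, A != 0 -> B != 0 -> p ^+ n * A = q ^+ n * B ->
  (deg A <= M)%N -> (deg B <= M)%N -> (n <= M)%N.
Proof.
move=> p0 q0 nc A B A0 B0 eAB dA dB.
apply: contraT; rewrite -ltnNge => lt_Mn; case: nc.
apply: is_constant_ratio => // x.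
have := congr1 (mup x) eAB; rewrite !mupM ?expf_neq0 // !mupX //.
have := leq_trans (mup_leq_deg x A0) dA.
have := leq_trans (mup_leq_deg x B0) dB.
move: (mup x p) (mup x q) (mup x A) (mup x B) => u v w z.
by case: (ltngtP u v) => //; nia.
Qed.

Lemma mult_independent_sym p q : mult_independent p q -> mult_independent q p.
Proof. by move=> ind r s; rewrite mulrC => /ind[-> ->]. Qed.

Lemma independent_power_bound p q n m M :
  p != 0 -> q != 0 -> (0 < deg p)%N -> mult_independent p q ->
  forall A B, A != 0 -> B != 0 -> p ^+ n * A = q ^+ m * B ->
  (deg A <= M)%N -> (deg B <= M)%N -> (n <= 2 * M * deg q)%N.
Proof.
move=> p0 q0 dp ind A B A0 B0 eAB dA dB.
apply: contraT; rewrite -ltnNge => lt_n.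
(* If some minor of the multiplicities of p and q at x and y were nonzero,
   eliminating m between the two local equations would bound n. Otherwise
   [p ^ mup x q] and [q ^ mup x p] have the same roots. *)
have minor_leq x y : (mup x p * mup y q <= mup y p * mup x q)%N.
  apply: contraT; rewrite -ltnNge => lt_xy.
  have mupE z : (n * mup z p + mup z A = m * mup z q + mup z B)%N.
    by have := congr1 (mup z) eAB; rewrite !mupM ?expf_neq0 // !mupX.
  have := mupE x; have := mupE y.
  have := leq_trans (mup_leq_deg y A0) dA.
  have := leq_trans (mup_leq_deg x B0) dB.
  have := mup_leq_deg x q0; have := mup_leq_deg y q0.
  move: lt_xy lt_n.
  move: (mup x p) (mup x q) (mup x A) (mup x B) => px qx ax bx.
  move: (mup y p) (mup y q) (mup y A) (mup y B) (deg q) => py qy ay yb D.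
  move=> lt_xy lt_n qyD qxD bxM ayM ey ex.
  (* Subtracting [h2] from [h1] eliminates [m]. The minor is at least 1, and the terms [bx * qy] and
     [ay * qx] give the two copies of [M * D]. *)
  have h1 : (n * px * qy + ax * qy = m * qx * qy + bx * qy)%N by nia.
  have h2 : (n * py * qx + ay * qx = m * qy * qx + yb * qx)%N by nia.
  have h3 : (n * (py * qx) + n <= n * (px * qy))%N by nia.
  have h4 : (bx * qy <= M * D)%N by apply: leq_mul.
  have h5 : (ay * qx <= M * D)%N by apply: leq_mul.
  nia.
(* A root of [p] makes the exponent of [q] in the relation nonzero, so the relation contradicts
   independence. *)
have [x rx] : exists x, root p x.
  by apply/closed_rootP; rewrite size_deg // eqSS -lt0n.
have mx : (0 < mup x p)%N.
  by rewrite -XsubC_dvd // -root_factor_theorem.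
have [] := ind (mup x q)%:Z (- (mup x p)%:Z).
  rewrite -exprnN -exprnP -!tofracXn.
  apply: is_constant_ratio; rewrite ?expf_neq0 // => y.
  rewrite !mupX //; apply/eqP; rewrite eqn_leq.
  by rewrite [(mup x q * _)%N]mulnC !minor_leq.
by move=> _ /eqP; rewrite oppr_eq0 => /eqP[] mx0; rewrite mx0 in mx.
Qed.

Lemma deg_gt0_nonconstant p : ~ is_constant (tofrac p) -> (0 < deg p)%N.
Proof.
move=> nc; rewrite ltnNge; apply/negP; rewrite size_le_deg => /size1_polyC ep.
by apply: nc; exists p`_0; rewrite {1}ep.
Qed.

End ClosedField.

(** * Degrees of the terms of a dominance-ordered recurrence *)

Section LeadingTerm.
Variables (F : fieldType) (d : nat) (a alpha : 'I_d.+1 -> {poly F}) (k : nat).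
Hypothesis dom : dominance_ordered a alpha k.

Lemma deg_term_leq_lead i n : (0 < n)%N ->
  (deg (a i * alpha i ^+ n)%R <= deg (a ord0 * alpha ord0 ^+ n)%R)%N.
Proof.
case: dom => /andP[k0 _] /[apply][[h1 h2 _]].
by have [ltik|leki] := ltnP i k; [rewrite (h1 i ord0)|exact/ltnW/h2].
Qed.

Lemma deg_term_eq_lead i n : (0 < n)%N ->
  deg (a i * alpha i ^+ n) = deg (a ord0 * alpha ord0 ^+ n) -> (i < k)%N.
Proof.
case: dom => /andP[k0 _] /[apply][[_ h2 _]] e.
rewrite ltnNge; apply/negP => leki.
by have := h2 ord0 i k0 leki; rewrite e ltnn.
Qed.

Lemma deg_lead_ltn n n' : a ord0 != 0 -> alpha ord0 != 0 ->
  (0 < deg (alpha ord0))%N -> (n' < n)%N ->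
  (deg (a ord0 * alpha ord0 ^+ n')%R < deg (a ord0 * alpha ord0 ^+ n)%R)%N.
Proof.
move=> a0 al0 d0 lt_n.
by rewrite !degM ?expf_neq0 // !degX ltn_add2l ltn_pmul2r.
Qed.

End LeadingTerm.

(* [8 * L ^ 4 = (2 * L) ^ 3 * L]: the equation has at most [2 * L] terms, and
   the product of the a's, alpha's, b's and beta's has degree at most [L]. *)
Definition lead_index_bound L := (2 * (L + 8 * L ^ 4) * L)%N.
Definition index_bound L := (L + lead_index_bound L * L)%N.

(** * The equation with ordered indices and the leading term of the first sequence dominant *)

Section PillaiEquation.
Variables (F : numClosedFieldType) (d t : nat).
Variables (a alpha : 'I_d.+1 -> {poly F}) (b beta : 'I_t.+1 -> {poly F}).
Variables (k l : nat) (Q : {poly F}) (L : nat).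
Hypothesis Q_neq0 : Q != 0.
Hypothesis degQ : (deg Q <= L)%N.
Hypothesis leL : (d.+1 + t.+1 <= L)%N.
Hypothesis dvd_a : forall i, a i %| Q.
Hypothesis dvd_alpha : forall i, alpha i %| Q.
Hypothesis dvd_b : forall j, b j %| Q.
Hypothesis dvd_beta : forall j, beta j %| Q.
Hypothesis dom_a : dominance_ordered a alpha k.
Hypothesis dom_b : dominance_ordered b beta l.
Hypothesis alpha_nc : ~ is_constant (tofrac (alpha ord0)).
Hypothesis beta_nc : ~ is_constant (tofrac (beta ord0)).
Hypothesis alpha_ratio : forall i : 'I_d.+1, (i < k)%N -> i != ord0 ->
  ~ is_constant (tofrac (alpha ord0) / tofrac (alpha i)).
Hypothesis alpha_beta : forall j : 'I_t.+1, (j < l)%N ->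
  mult_independent (alpha ord0) (beta j).

Let dvd_neq0 p : p %| Q -> p != 0.
Proof. by move=> pQ; apply: dvdpN0 pQ Q_neq0. Qed.

Let dvd_deg p : p %| Q -> (deg p <= L)%N.
Proof.
move=> pQ; apply: leq_trans degQ; rewrite -ltnS -!size_deg ?dvd_neq0 //.
exact: dvdp_leq.
Qed.

(* The scalar [e] makes the two sequences play symmetric roles and covers both
   orders of m_1 and m_2. *)
Variables (n n' m m' : nat) (e : F).
Hypotheses (n'_gt0 : (0 < n')%N) (m'_gt0 : (0 < m')%N).
Hypotheses (lt_n : (n' < n)%N) (lt_m : (m' < m)%N) (e_neq0 : e != 0).
Hypothesis eq0 : recseq a alpha n - recseq a alpha n' +
  e *: (recseq b beta m - recseq b beta m') = 0.
Hypothesis lead_leq :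
  (deg (b ord0 * beta ord0 ^+ m)%R <= deg (a ord0 * alpha ord0 ^+ n)%R)%N.

Let I : finType := (bool * ('I_d.+1 + 'I_t.+1))%type.

Let scal (x : I) : F :=
  (-1) ^+ (~~ x.1) * (if x.2 is inl _ then 1 else e).

Let monom (x : I) : {poly F} :=
  match x.2 with
  | inl i => a i * alpha i ^+ (if x.1 then n else n')
  | inr j => b j * beta j ^+ (if x.1 then m else m')
  end.

Let term (x : I) : {poly F} := (scal x)%:P * monom x.

Let top : I := (true, inl ord0).

Let scal_neq0 x : scal x != 0.
Proof.
by rewrite mulf_neq0 ?signr_eq0 //; case: x.2 => _; rewrite ?oner_eq0.
Qed.

Let monom_neq0 x : monom x != 0.
Proof.
by rewrite /monom; case: x.2 => i; rewrite mulf_neq0 ?expf_neq0 ?dvd_neq0.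
Qed.

Let deg_term x : deg (term x) = deg (monom x).
Proof. by rewrite degM ?polyC_eq0 // /deg size_polyC scal_neq0. Qed.

Let term_log x : log_derivable Q (term x).
Proof.
apply: log_derivableM; first exact: log_derivableC.
have lf p : p %| Q -> log_derivable Q p by apply: log_derivable_dvd.
by rewrite /monom; case: x.2 => i; apply: log_derivableM;
  do 1?apply: log_derivableX; apply: lf.
Qed.

Let sum_term : \sum_x term x = 0.
Proof.
rewrite -[RHS]eq0 -(pair_bigA _ (fun s z => term (s, z))) big_bool /=.
rewrite !big_sumType /= /term /scal /monom /=.
rewrite /recseq -!sumrB scaler_sumr.
rewrite addrACA -!big_split /=; congr (_ + _); apply: eq_bigr => i _.
  by rewrite expr0 expr1 !mulr1 polyCN mulN1r mul1r.
by rewrite expr0 expr1 mulN1r mul1r polyCN !mulNr -mulrBr mul_polyC.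
Qed.

Let alpha_deg : (0 < deg (alpha ord0))%N := deg_gt0_nonconstant alpha_nc.
Let beta_deg : (0 < deg (beta ord0))%N := deg_gt0_nonconstant beta_nc.

Let deg_term_leq_top x : (deg (monom x) <= deg (monom top))%N.
Proof.
case: x => [[] [i|j]]; rewrite /monom /top /=.
- by apply: (deg_term_leq_lead dom_a); apply: leq_trans n'_gt0 (ltnW lt_n).
- apply: leq_trans lead_leq; apply: (deg_term_leq_lead dom_b).
  exact: leq_trans m'_gt0 (ltnW lt_m).
- apply: leq_trans (deg_term_leq_lead dom_a _ n'_gt0) _.
  by apply/ltnW/deg_lead_ltn; rewrite ?dvd_neq0.
- apply: leq_trans (deg_term_leq_lead dom_b _ m'_gt0) _.
  apply: leq_trans lead_leq.
  by apply/ltnW/deg_lead_ltn; rewrite ?dvd_neq0.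
Qed.

(** The leading roots are nonconstant, so every term at [n'] or [m'] has degree strictly below the
    top; only relevant roots at [n] or [m] can tie. *)
Let deg_term_eq_top x : deg (monom x) = deg (monom top) -> x != top ->
  (exists2 i : 'I_d.+1, x = (true, inl i) & (i < k)%N /\ i != ord0) \/
  (exists2 j : 'I_t.+1, x = (true, inr j) & (j < l)%N).
Proof.
case: x => [[] [i|j]]; rewrite /monom /top /= => eD nt.
- left; exists i => //; split; last by apply: contraNneq nt => ->.
  exact: (deg_term_eq_lead dom_a (leq_trans n'_gt0 (ltnW lt_n))) eD.
- right; exists j => //.
  have m_gt0 := leq_trans m'_gt0 (ltnW lt_m).
  apply: (deg_term_eq_lead dom_b m_gt0); apply/eqP.
  by rewrite eqn_leq (deg_term_leq_lead dom_b) // eD lead_leq.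
- have : (deg (a i * alpha i ^+ n')%R < deg (a ord0 * alpha ord0 ^+ n)%R)%N.
    apply: leq_ltn_trans (deg_term_leq_lead dom_a _ n'_gt0) _.
    by apply: deg_lead_ltn; rewrite ?dvd_neq0.
  by rewrite eD ltnn.
- have : (deg (b j * beta j ^+ m')%R < deg (a ord0 * alpha ord0 ^+ n)%R)%N.
    apply: leq_ltn_trans (deg_term_leq_lead dom_b _ m'_gt0) _.
    apply: leq_trans lead_leq.
    by apply: deg_lead_ltn; rewrite ?dvd_neq0.
  by rewrite eD ltnn.
Qed.

(** Without a second term of top degree, the coefficient of the vanishing subsum in that degree
    would be the leading coefficient of [term top]. *)
Let partner : exists x, [/\ x != top, deg (monom x) = deg (monom top)
  & ratio_bounded (8 * L ^ 4) (term top) (term x)].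
Proof.
have [J [Jtop sumJ hJ]] := vanishing_sum_component Q_neq0 top term_log sum_term.
have [/existsP[x /and3P[Jx nx /eqP dx]]|no] :=
  boolP [exists x, [&& x \in J, x != top & deg (monom x) == deg (monom top)]].
  exists x; split=> //; apply: ratio_bounded_leq (hJ x Jx).
  rewrite card_prod card_bool card_sum !card_ord.
  rewrite expnS [(8 * _)%N]mulnC.
  have h : ((2 * (d.+1 + t.+1)) ^ 3 <= (2 * L) ^ 3)%N.
    by rewrite leq_exp2r ?leq_mul2l.
  rewrite -expnS; apply: leq_trans (leq_mul h degQ) _.
  by rewrite expnMn; lia.
have := congr1 (fun p : {poly F} => p`_(deg (term top))) sumJ.
rewrite coef0 coef_sum (bigD1 top) //= big1 ?addr0 => [/eqP|x /andP[Jx nx]].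
  rewrite -lead_coefE lead_coef_eq0 mulf_eq0 polyC_eq0.
  by rewrite (negbTE (scal_neq0 _)) (negbTE (monom_neq0 _)).
rewrite nth_default // size_deg ?mulf_neq0 ?polyC_eq0 // !deg_term ltn_neqAle.
rewrite deg_term_leq_top andbT; apply: contra no => dx.
by apply/existsP; exists x; rewrite Jx nx.
Qed.

(** The bounded ratio with the partner becomes an identity between a power of [alpha ord0] and one
    of [alpha i] or [beta j], up to cofactors of degree at most [L + 8 * L ^ 4] absorbing scalars
    and coefficients. *)
Lemma lead_index_leq : (n <= lead_index_bound L)%N.
Proof.
have [x [nx dx [G [H [G0 H0 eGH dG dH]]]]] := partner.
have lead_deg c i (p : {poly F}) : c != 0 -> p %| Q -> (deg i <= 8 * L ^ 4)%N ->
    (deg (c%:P * p * i)%R <= L + 8 * L ^ 4)%N.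
  move=> c0 pQ di; apply: leq_trans (deg_mul_leq _ _) _; apply: leq_add => //.
  apply: leq_trans (deg_mul_leq _ _) _.
  by rewrite [deg _%:P]/deg size_polyC c0 add0n dvd_deg.
have fac_neq0 c i (p : {poly F}) : c != 0 -> p %| Q -> i != 0 ->
    c%:P * p * i != 0.
  by move=> c0 pQ i0; rewrite mulf_neq0 // mulf_neq0 ?polyC_eq0 ?dvd_neq0.
have L_gt0 : (0 < L)%N by apply: leq_trans leL; rewrite addSn.
have [[i ex [ik i0]]|[j ex jl]] := deg_term_eq_top dx nx.
  have e_pow : alpha ord0 ^+ n * ((scal top)%:P * a ord0 * G) =
               alpha i ^+ n * ((scal x)%:P * a i * H).
    by move: eGH; rewrite ex /term /monom /top /= => eGH; ring: eGH.
  apply: leq_trans (ratio_power_bound (M := L + 8 * L ^ 4) _ _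
                      (alpha_ratio ik i0) _ _ e_pow _ _) _;
    rewrite ?fac_neq0 ?lead_deg //; do ?exact: dvd_neq0.
  by rewrite /lead_index_bound mulnAC leq_pmull // muln_gt0.
have e_pow : alpha ord0 ^+ n * ((scal top)%:P * a ord0 * G) =
             beta j ^+ m * ((scal x)%:P * b j * H).
  by move: eGH; rewrite ex /term /monom /top /= => eGH; ring: eGH.
apply: leq_trans (independent_power_bound (M := L + 8 * L ^ 4) _ _ _
                    (alpha_beta jl) _ _ e_pow _ _) _;
  rewrite ?fac_neq0 ?lead_deg //; do ?exact: dvd_neq0.
by rewrite leq_mul ?dvd_deg.
Qed.

(** Since [beta ord0] has positive degree, [m] is at most the degree of the leading term of the
    second sequence, hence at most that of the first, which is at most [L + n * L]. *)
Lemma index_leq : (n <= index_bound L)%N /\ (m <= index_bound L)%N.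
Proof.
have hn := lead_index_leq.
have L_gt0 : (0 < L)%N by apply: leq_trans leL; rewrite addSn.
split.
  apply: leq_trans hn _; apply: leq_trans (leq_addl _ _).
  by rewrite leq_pmulr.
apply: leq_trans (leq_trans lead_leq _); last first.
  rewrite degM ?expf_neq0 ?dvd_neq0 // degX leq_add ?leq_mul ?dvd_deg //.
rewrite degM ?expf_neq0 ?dvd_neq0 // degX.
by apply: leq_trans (leq_addl _ _); rewrite leq_pmulr.
Qed.

End PillaiEquation.

(** * Number of terms and degrees against the length of the input *)

Section Encoding.
Variable F : fieldType.

Lemma size_encode_family d (u : 'I_d.+1 -> {poly F}) :
  size (encode_family u) = (\sum_i (size (u i)).+1).+1.
Proof.
rewrite /= size_flatten /shape -map_comp sumnE big_map big_enum /=.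
by congr (_.+1); apply: eq_bigr.
Qed.

Lemma size_encode_family_geq d (u : 'I_d.+1 -> {poly F}) :
  (d.+1 + \sum_i deg (u i) <= size (encode_family u))%N.
Proof.
rewrite size_encode_family ltnW // ltnS -[X in (X + _)%N]card_ord -sum1_card.
by rewrite -big_split /= leq_sum // => i _; rewrite add1n ltnS leq_pred.
Qed.

(** A common multiple of all the data, to be used as [Q]. *)
Definition data_prod (d t : nat) (a alpha : 'I_d.+1 -> {poly F})
    (b beta : 'I_t.+1 -> {poly F}) : {poly F} :=
  (\prod_i a i * \prod_i alpha i) * (\prod_j b j * \prod_j beta j).

Variables (d t : nat) (a alpha : 'I_d.+1 -> {poly F}).
Variables (b beta : 'I_t.+1 -> {poly F}).

Lemma dvd_data_prod :
  [/\ forall i, a i %| data_prod a alpha b beta,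
      forall i, alpha i %| data_prod a alpha b beta,
      forall j, b j %| data_prod a alpha b beta
    & forall j, beta j %| data_prod a alpha b beta].
Proof.
have dvd_prod (n : nat) (u : 'I_n -> {poly F}) i : u i %| \prod_j u j.
  by rewrite (bigD1 i) //= dvdp_mulr.
rewrite /data_prod; split=> i.
- by do 2!apply: dvdp_mulr.
- by apply: dvdp_mulr; apply: dvdp_mull.
- by apply: dvdp_mull; apply: dvdp_mulr.
- by do 2!apply: dvdp_mull.
Qed.

Lemma deg_data_prod :
  (deg (data_prod a alpha b beta) <= size (encode_data a alpha b beta))%N.
Proof.
have deg_leq e (u : 'I_e.+1 -> {poly F}) :
    (deg (\prod_i u i) <= size (encode_family u))%N.
  apply: leq_trans (deg_prod_leq (fun i => leqnn (deg (u i)))) _.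
  by apply: leq_trans (size_encode_family_geq u); apply: leq_addl.
rewrite !size_cat addnA; apply: leq_trans (deg_mul_leq _ _) _.
apply: leq_add; apply: leq_trans (deg_mul_leq _ _) _; exact: leq_add.
Qed.

Lemma size_encode_data_geq :
  (d.+1 + t.+1 <= size (encode_data a alpha b beta))%N.
Proof.
rewrite !size_cat addnA; apply: leq_add.
  apply: leq_trans (leq_addr _ _).
  by apply: leq_trans (size_encode_family_geq a); apply: leq_addr.
apply: leq_trans (leq_addr _ _).
by apply: leq_trans (size_encode_family_geq b); apply: leq_addr.
Qed.

End Encoding.

(** * The bounding program and the final case analysis *)

Lemma mem_relevant_roots (F : fieldType) d (alpha : 'I_d.+1 -> {poly F}) k
    (i : 'I_d.+1) : (i < k)%N -> alpha i \in relevant_roots alpha k.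
Proof. by move=> ik; rewrite map_f // mem_filter ik mem_enum. Qed.

(** Register 0 starts with the input length, so one assignment suffices and termination is
    immediate. *)
Definition index_bound_prog : cmd :=
  let L := NReg 0 in
  let L4 := NMul (NMul L L) (NMul L L) in
  let K := NMul (NMul (NConst 2) (NAdd L (NMul (NConst 8) L4))) L in
  SetReg 0 (NAdd L (NMul K L)).

Lemma outputs_index_bound (F : fieldType) (w : seq F) :
  outputs index_bound_prog w (index_bound (size w)).
Proof.
eexists; first exact: ExecSetReg.
by rewrite /= /index_bound /lead_index_bound !expnS expn0 muln1 !mulnA.
Qed.

Theorem theorem4 (R : realType) :
  exists P : cmd,
  forall (d t : nat) (a alpha : 'I_d.+1 -> {poly R[i]})
         (b beta : 'I_t.+1 -> {poly R[i]}) (k l : nat),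
  simple_recurrence a alpha -> simple_recurrence b beta ->
  weak_coefficients a alpha -> weak_coefficients b beta ->
  dominance_ordered a alpha k -> dominance_ordered b beta l ->
  let RG := relevant_roots alpha k in
  let RH := relevant_roots beta l in
  (forall g, g \in RG -> ~ is_constant (tofrac g)) ->
  (forall h, h \in RH -> ~ is_constant (tofrac h)) ->
  (forall g g', g \in RG -> g' \in RG -> g <> g' ->
     ~ is_constant (tofrac g / tofrac g')) ->
  (forall h h', h \in RH -> h' \in RH -> h <> h' ->
     ~ is_constant (tofrac h / tofrac h')) ->
  (forall h, h \in RH -> mult_independent (alpha ord0) h) ->
  (forall g, g \in RG -> mult_independent g (beta ord0)) ->
  no_multiple_values a alpha -> no_multiple_values b beta ->
  exists C : nat,
    outputs P (encode_data a alpha b beta) C /\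
    forall n1 m1 n2 m2 : nat,
      (0 < n1)%N -> (0 < m1)%N -> (0 < n2)%N -> (0 < m2)%N ->
      (n1, m1) <> (n2, m2) ->
      recseq a alpha n1 - recseq b beta m1 =
      recseq a alpha n2 - recseq b beta m2 ->
      (maxn (maxn n1 m1) (maxn n2 m2) <= C)%N.
Proof.
exists index_bound_prog => d t a alpha b beta k l.
move=> [a0 alpha0 alpha_inj] [b0 beta0 beta_inj] _ _ domG domH /=.
move=> ncG ncH ratioG ratioH indGH indHG injG injH.
set L := size (encode_data a alpha b beta).
exists (index_bound L); split; first exact: outputs_index_bound.
have [k_gt0 l_gt0] : (0 < k)%N /\ (0 < l)%N.
  by case: domG domH => /andP[? _] _ [/andP[? _] _].
have alphaG (i : 'I_d.+1) : (i < k)%N -> alpha i \in relevant_roots alpha k.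
  exact: mem_relevant_roots.
have betaH (j : 'I_t.+1) : (j < l)%N -> beta j \in relevant_roots beta l.
  exact: mem_relevant_roots.
pose Q := data_prod a alpha b beta.
have [dva dval dvb dvbe] := dvd_data_prod a alpha b beta.
have Q0 : Q != 0 by rewrite !mulf_neq0 //; apply/prodf_neq0 => i _.
have degQ : (deg Q <= L)%N := deg_data_prod a alpha b beta.
have leL : (d.+1 + t.+1 <= L)%N := size_encode_data_geq a alpha b beta.
have key n n' m m' (e : R[i]) : (0 < n')%N -> (0 < m')%N ->
    (n' < n)%N -> (m' < m)%N -> e != 0 ->
    recseq a alpha n - recseq a alpha n' +
      e *: (recseq b beta m - recseq b beta m') = 0 ->
    (n <= index_bound L)%N /\ (m <= index_bound L)%N.
  move=> n'0 m'0 lt_n lt_m e0 eq0.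
  (* If the leading term of H has the larger degree, the two sequences are exchanged and [e] is
     replaced by its inverse. *)
  have [leHG|/ltnW leGH] := leqP (deg (b ord0 * beta ord0 ^+ m))
                           (deg (a ord0 * alpha ord0 ^+ n)).
    apply: (index_leq Q0 degQ leL dva dval dvb dvbe domG domH _ _ _ _
              n'0 m'0 lt_n lt_m e0 eq0 leHG).
    - exact/ncG/alphaG.
    - exact/ncH/betaH.
    - move=> i ik i0; apply: ratioG; rewrite ?alphaG // => /alpha_inj i00.
      by rewrite -i00 eqxx in i0.
    - by move=> j jl; apply/indGH/betaH.
  suff [] : (m <= index_bound L)%N /\ (n <= index_bound L)%N by [].
  rewrite addnC in leL.
  have eq0' : recseq b beta m - recseq b beta m' +
      e^-1 *: (recseq a alpha n - recseq a alpha n') = 0.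
    move/eqP: eq0; rewrite addr_eq0 => /eqP->.
    by rewrite scalerN scalerA mulVf // scale1r subrr.
  apply: (index_leq Q0 degQ leL dvb dvbe dva dval domH domG _ _ _ _
            m'0 n'0 lt_m lt_n (invr_neq0 e0) eq0' leGH).
  - exact/ncH/betaH.
  - exact/ncG/alphaG.
  - move=> j jl j0; apply: ratioH; rewrite ?betaH // => /beta_inj j00.
    by rewrite -j00 eqxx in j0.
  - by move=> i ik; apply/mult_independent_sym/indHG/alphaG.
have step n n' m m' : (0 < m)%N -> (0 < n')%N -> (0 < m')%N -> (n' < n)%N ->
    recseq a alpha n - recseq b beta m = recseq a alpha n' - recseq b beta m' ->
    [/\ (n <= index_bound L)%N, (m <= index_bound L)%N
      & (m' <= index_bound L)%N].
  move=> m_gt0 n'_gt0 m'_gt0 lt_n eqGH.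
  have eqG : recseq a alpha n - recseq a alpha n' =
             recseq b beta m - recseq b beta m'.
    by rewrite -[recseq a alpha n](subrK (recseq b beta m)) eqGH; ring.
  (* The sign [e] is 1 or -1 according to the order of [m] and [m']. If they are equal, G takes the
     same value at [n] and [n'], against injectivity. *)
  have [lt_m|lt_m|em] := ltngtP m m'.
  - have [|hn hm] := key n n' m' m 1 n'_gt0 m_gt0 lt_n lt_m (oner_neq0 _).
      by rewrite eqG scale1r; ring.
    by split=> //; apply: leq_trans (ltnW lt_m) hm.
  - have [||hn hm] := key n n' m m' (-1) n'_gt0 m'_gt0 lt_n lt_m.
    + by rewrite oppr_eq0 oner_eq0.
    + by rewrite eqG scaleN1r subrr.
    by split=> //; apply: leq_trans (ltnW lt_m) hm.
  have := injG n n' (leq_trans n'_gt0 (ltnW lt_n)) n'_gt0.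
  move: eqG; rewrite em subrr => /eqP; rewrite subr_eq0.
  move=> /eqP eqG /(_ eqG) enn.
  by rewrite enn ltnn in lt_n.
move=> n1 m1 n2 m2 n1_gt0 m1_gt0 n2_gt0 m2_gt0 ne eqGH.
rewrite !geq_max.
(* When [n1 = n2], the values of H agree as well, so [m1 = m2] and the pairs are not distinct. *)
have [lt_n|lt_n|en] := ltngtP n1 n2.
- have [-> -> ->] := step _ _ _ _ m2_gt0 n1_gt0 m1_gt0 lt_n (esym eqGH).
  have [h _ _] := step _ _ _ _ m2_gt0 n1_gt0 m1_gt0 lt_n (esym eqGH).
  by rewrite (leq_trans (ltnW lt_n) h).
- have [h -> ->] := step _ _ _ _ m1_gt0 n2_gt0 m2_gt0 lt_n eqGH.
  by rewrite h (leq_trans (ltnW lt_n) h).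
case: ne; congr (_, _) => //; apply: injH => //.
by move: eqGH; rewrite en => /addrI/oppr_inj.
Qed.
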